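(* Let $m,s\in\mathbb N$, let $\mathcal F$ be a Ferrers diagram of order $s$ and let $\mathcal F^m$ be its $m$-block version. Let $\delta\in[s]$ and $d\in[sm]$ be such that $d-1=m(\delta-1)$. Then $(\mathcal F,\delta)$ is MDS-constructible if and only if $(\mathcal F^m,d)$ is MSRD-constructible.
   Context: Notation: $\mathbb N=\{1,2,\dots\}$ and $[n]=\{1,\dots,n\}$, $[0]=\emptyset$. A (top-right justified) Ferrers diagram of order $n$ is a subset $\mathcal F\subseteq[n]^2$ such that (1) $(i,j)\in\mathcal F$ and $j<n$ imply $(i,j+1)\in\mathcal F$; (2) $(i,j)\in\mathcal F$ and $i>1$ imply $(i-1,j)\in\mathcal F$. Write $\mathcal F=[c_1,\dots,c_n]$ where $c_j$ is the number of elements of $\mathcal F$ in column $j$. For $d\in[n]$ and $j\in\{0,\dots,d-1\}$ let $\nu_j(\mathcal F,d)=\sum_{i=1}^{n-j}\max\{0,c_i-d+1+j\}$ and $\nu_{\min}(\mathcal F,d)=\min_{0\le j\le d-1}\nu_j(\mathcal F,d)$. Diagonals of $[n]^2$: $D_i=\{(l,n-i+l):1\le l\le i\}$, $i\in[n]$. For $\mathcal F$ of order $n$ and $d\in[n]$, the pair $(\mathcal F,d)$ is MDS-constructible if $\nu_{\min}(\mathcal F,d)=\sum_{i=1}^n\max\{|D_i\cap\mathcal F|-d+1,0\}$. Blocks: $Q_{i,j}=Q_{i,j}^{(m)}:=([im]\setminus[(i-1)m])\times([jm]\setminus[(j-1)m])$. A Ferrers diagram $\mathcal G$ of order $sm$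 is an $m$-block Ferrers diagram if $Q_{i,j}\cap\mathcal G\in\{\emptyset,Q_{i,j}\}$ for all $i,j\in[s]$; its block set is $\mathbf B(\mathcal G)=\{Q_{i,j}: i,j\in[s],\ Q_{i,j}\subseteq\mathcal G\}$. Block diagonals: $D_i^B=\{Q_{l,s-i+l}:1\le l\le i\}$, $i\in[s]$. For an $m$-block diagram $\mathcal G$ of order $sm$ and $d\in[sm]$, the pair $(\mathcal G,d)$ is MSRD-constructible if $\nu_{\min}(\mathcal G,d)=m\sum_{i=1}^s\max\{m|D_i^B\cap\mathbf B(\mathcal G)|-d+1,0\}$. The $m$-block version of a Ferrers diagram $\mathcal F$ of order $s$ is $\mathcal F^m:=\bigcup_{(i,j)\in\mathcal F}Q_{i,j}^{(m)}$, an $m$-block Ferrers diagram of order $sm$. *)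

(* Defs.v *)
From mathcomp Require Import all_boot.
From mathcomp Require Import zify.

Set Implicit Arguments.
Unset Strict Implicit.
Unset Printing Implicit Defensive.

(* Cells of [n]^2 are pairs (row, column) of ordinals, so rows, columns and
   block coordinates are counted from 0: the cell (i, j) of the literature is
   (i - 1, j - 1) here.  Diagonals D_i keep their index i in {1, ..., n}. *)

Definition is_ferrers n (F : {set 'I_n * 'I_n}) : Prop :=
  (forall i j j' : 'I_n, (i, j) \in F -> j' = j.+1 :> nat -> (i, j') \in F) /\
  (forall i i' j : 'I_n, (i, j) \in F -> i = i'.+1 :> nat -> (i', j) \in F).

Record ferrers (n : nat) := Ferrers {
  cells :> {set 'I_n * 'I_n};
  ferrersP : is_ferrers cells }.

Definition col_size n (F : {set 'I_n * 'I_n}) (j : 'I_n) : nat :=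
  #|[set p in F | p.2 == j]|.

(* In each summand below, truncated subtraction computes max {0, a - d + 1}
   as a.+1 - d. *)
Definition nu n (F : ferrers n) (d j : nat) : nat :=
  \sum_(i < n | i < n - j) ((col_size F i + j).+1 - d).

(* For d > 0 the index j = 0 belongs to the range, so the initial value of the
   iterated minimum does not affect it. *)
Definition nu_min n (F : ferrers n) (d : nat) : nat :=
  \big[minn/nu F d 0]_(j < d) nu F d j.

Definition diagonal n (i : nat) : {set 'I_n * 'I_n} :=
  [set p : 'I_n * 'I_n | (p.1 < i) && (p.2 == n - i + p.1 :> nat)].

Definition MDS_constructible n (F : ferrers n) (d : nat) : Prop :=
  nu_min F d = \sum_(1 <= i < n.+1) (#|diagonal n i :&: F|.+1 - d).

Definition block m s (i j : 'I_s) : {set 'I_(s * m) * 'I_(s * m)} :=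
  [set p : 'I_(s * m) * 'I_(s * m) |
     (i * m <= p.1 < i.+1 * m) && (j * m <= p.2 < j.+1 * m)].

Definition is_block_diagram m s (G : {set 'I_(s * m) * 'I_(s * m)}) : Prop :=
  forall i j : 'I_s,
    block m i j :&: G = set0 \/ block m i j :&: G = block m i j.

Record block_ferrers (m s : nat) := BlockFerrers {
  diagram :> ferrers (s * m);
  block_ferrersP : is_block_diagram diagram }.

Definition blocks m s (G : block_ferrers m s) :
    {set {set 'I_(s * m) * 'I_(s * m)}} :=
  [set block m p.1 p.2 | p : 'I_s * 'I_s & block m p.1 p.2 \subset G].

Definition block_diagonal m s (i : nat) :
    {set {set 'I_(s * m) * 'I_(s * m)}} :=
  [set block m p.1 p.2 | p in diagonal s i].

Definition MSRD_constructible m s (G : block_ferrers m s) (d : nat) : Prop :=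
  nu_min G d =
    m * \sum_(1 <= i < s.+1) ((m * #|block_diagonal m s i :&: blocks G|).+1 - d).

Definition block_union m s (F : {set 'I_s * 'I_s}) :
    {set 'I_(s * m) * 'I_(s * m)} :=
  \bigcup_(p in F) block m p.1 p.2.

Lemma block_union_ferrers m s (F : ferrers s) : is_ferrers (block_union m F).
Proof.
have [FR FU] := ferrersP F; split.
- move=> x y y' /bigcupP[[i j] /= Fij]; rewrite inE /=.
  move=> /andP[xi /andP[jy yj]] ey.
  have [lt|ge] := ltnP y' (j.+1 * m).
    by apply/bigcupP; exists (i, j); rewrite // inE /= xi lt ey leqW.
  have js : j.+1 < s by have := ltn_ord y'; nia.
  apply/bigcupP; exists (i, Ordinal js); first exact: FR Fij _.
  by rewrite inE /= xi ge /=; nia.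
- move=> x x' y /bigcupP[[i j] /= Fij]; rewrite inE /=.
  move=> /andP[/andP[ix xi] yj] ex.
  have [le|lt] := leqP (i * m) x'.
    by apply/bigcupP; exists (i, j); rewrite // inE /= yj le andbT; lia.
  have is_ : i.-1 < s by have := ltn_ord i; lia.
  have i0 : 0 < i by nia.
  apply/bigcupP; exists (Ordinal is_, j); first by apply: FU Fij _ => /=; lia.
  by rewrite inE /= yj andbT; nia.
Qed.

Lemma block_union_block m s (F : {set 'I_s * 'I_s}) :
  is_block_diagram (block_union m F).
Proof.
move=> i j; have [Fij|nFij] := boolP ((i, j) \in F); [right|left].
  by apply/setIidPl; apply: (bigcup_sup (i, j)).
apply/setP=> -[x y]; rewrite in_set0; apply/negP; rewrite inE => /andP[].
rewrite inE /= => xy /bigcupP[[k l] /= Fkl]; rewrite inE /= => xy'.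
have ek : k = i by apply: val_inj => /=; nia.
have el : l = j by apply: val_inj => /=; nia.
by move: nFij; rewrite -ek -el Fkl.
Qed.

Definition block_version m s (F : ferrers s) : block_ferrers m s :=
  @BlockFerrers m s (Ferrers (block_union_ferrers m F))
    (block_union_block m F).

(* Main.v *)
Require Import Defs.
From mathcomp Require Import all_boot.
From mathcomp Require Import zify.

(** Put [d - 1 = m (delta - 1)].  The theorem holds because both sides of the
    constructibility equation are multiplied by exactly [m ^ 2] when a diagram
    is replaced by its [m]-block version.

    On the right-hand side this is a count: [(i, j) |-> block m i j] is
    injective, so block diagonals meet the blocks of [F^m] in as many blocks as
    diagonals meet [F] in cells ([card_block_diagonal]), and
    [m k - d + 1 = m (k - delta + 1)].

    On the left-hand side the point is [nu_min_block_version].  The columns of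
    [F^m] come in [s] groups of [m] equal columns, the [b]-th group having
    height [m c_b], which gives a closed formula for [nu_j (F^m, d)]
    ([nu_block_version]).  It yields [nu_(q m) (F^m, d) = m ^ 2 nu_q (F, delta)],
    so the minimum over the [j] divisible by [m] is the expected one.  The other
    [j] cannot lower it, because [j |-> nu_j (F^m, d)] is concave on every
    interval [q m <= j <= (q + 1) m].  Indeed each group of columns contributes
    on such an interval zero, or a constant multiple of an affine function of
    [j], or (for the one group that is being truncated, with [j = q m + r]) the
    product [(m - r) (m a + r)] with [a >= 0], all of which are concave.  A
    concave function on an interval is bounded below by its values at the
    endpoints. *)

(** * The minimum of the bounds [nu] *)

Lemma nu_min_le n (F : ferrers n) d j : j < d -> nu_min F d <= nu F d j.
Proof.
move=> jd; rewrite /nu_min; have := mem_index_enum (Ordinal jd).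
elim: (index_enum _) => // k r IH; rewrite in_cons big_cons geq_min.
by case/predU1P => [<-|/IH ->]; rewrite ?leqnn ?orbT.
Qed.

Lemma nu_min_attained n (F : ferrers n) d :
  0 < d -> exists2 j, j < d & nu_min F d = nu F d j.
Proof.
move=> d0; apply: (big_ind (fun x => exists2 j, j < d & x = nu F d j)).
- by exists 0.
- move=> x y [j jd ->] [k kd ->].
  by rewrite /minn; case: ifP => _; [exists j | exists k].
- by move=> j _; exists j.
Qed.

(** * Counting columns, cells and blocks of the block version *)

Lemma card_ord_interval n a b : b <= n -> #|[set i : 'I_n | a <= i < b]| = b - a.
Proof.
move=> bn; rewrite -sum1_card (eq_bigl (fun i : 'I_n => (a <= i) && (i < b)));
  last by move=> i; rewrite inE.
rewrite -(big_ord_widen_cond _ (fun i => a <= i) (fun=> 1) bn).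
by rewrite -(big_geq_mkord a b xpredT (fun=> 1)) sum_nat_const_nat muln1.
Qed.

Section BlockVersion.

Variables (m s : nat).
Hypothesis m_gt0 : 0 < m.

Lemma block_index_proof (x : 'I_(s * m)) : x %/ m < s.
Proof. by rewrite ltn_divLR. Qed.

Definition block_index (x : 'I_(s * m)) : 'I_s := Ordinal (block_index_proof x).

Lemma block_index_surj (b : 'I_s) : exists x, block_index x = b.
Proof.
have bm : b * m < s * m by rewrite ltn_mul2r m_gt0 ltn_ord.
by exists (Ordinal bm); apply: val_inj; rewrite /= mulnK.
Qed.

Lemma block_indexE (x : 'I_(s * m)) (b : 'I_s) :
  (block_index x == b) = (b * m <= x < b.+1 * m).
Proof.
by rewrite -val_eqE /= eqn_leq -ltnS ltn_divLR // leq_divRL // andbC.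
Qed.

Lemma in_block (i j : 'I_s) (x y : 'I_(s * m)) :
  ((x, y) \in block m i j) = (block_index x == i) && (block_index y == j).
Proof. by rewrite inE !block_indexE. Qed.

Lemma in_block_union (F : {set 'I_s * 'I_s}) (x y : 'I_(s * m)) :
  ((x, y) \in block_union m F) = ((block_index x, block_index y) \in F).
Proof.
apply/bigcupP/idP => [[[i j] Fij]|Fxy].
  by rewrite in_block => /andP[/eqP -> /eqP ->].
by exists (block_index x, block_index y); rewrite // in_block !eqxx.
Qed.

(** The truncation by [j] removes [j] columns from the right, so it leaves
    [(s - b) m - j] columns of the [b]-th group, cut off at [0] and [m]. *)
Lemma card_truncated_column_group (b : 'I_s) j :
  #|[set x : 'I_(s * m) | (x < s * m - j) && (block_index x == b)]| =
    minn m ((s - b) * m - j).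
Proof.
have bs : b.+1 * m <= s * m by rewrite leq_mul2r ltn_ord orbT.
rewrite -[RHS](_ : minn (b.+1 * m) (s * m - j) - b * m = _); last first.
  rewrite mulnBl mulSn; lia.
rewrite -(@card_ord_interval (s * m) (b * m)); last lia.
by apply: eq_card => x; rewrite !inE block_indexE; lia.
Qed.

Lemma card_block_index (b : 'I_s) :
  #|[set x : 'I_(s * m) | block_index x == b]| = m.
Proof.
have bs : b.+1 * m <= s * m by rewrite leq_mul2r ltn_ord orbT.
rewrite -[RHS](_ : b.+1 * m - b * m = _); last by rewrite mulSn; lia.
rewrite -(@card_ord_interval (s * m) (b * m)) //.
by apply: eq_card => x; rewrite !inE block_indexE.
Qed.

Lemma card_column n (F : {set 'I_n * 'I_n}) (j : 'I_n) :
  col_size F j = #|[set i | (i, j) \in F]|.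
Proof.
rewrite /col_size -[RHS](card_imset _ (_ : injective (fun i => (i, j)))); last first.
  by move=> i i' [].
apply: eq_card => -[i j']; rewrite !inE /=.
apply/andP/imsetP => [[Fij /eqP ej]|[i' ]].
  by subst j'; exists i; rewrite ?inE.
by rewrite inE => Fi [-> ->].
Qed.

Lemma col_size_block_union (F : {set 'I_s * 'I_s}) (y : 'I_(s * m)) :
  col_size (block_union m F) y = m * col_size F (block_index y).
Proof.
rewrite !card_column -!sum1_card big_distrr /=.
rewrite (partition_big block_index (mem [set i | (i, block_index y) \in F])) /=;
  last by move=> x; rewrite !inE in_block_union.
apply: eq_bigr => i; rewrite inE => Fi.
rewrite muln1 -[RHS](card_block_index i) -sum1_card; apply: eq_bigl => x.
rewrite !inE in_block_union; case: eqP => [->|//]; first by rewrite Fi.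
by rewrite andbF.
Qed.

Lemma nu_block_version (F : ferrers s) d j :
  nu (block_version m F) d j =
    \sum_(b < s) minn m ((s - b) * m - j) * ((m * col_size F b + j).+1 - d).
Proof.
rewrite /nu (partition_big block_index predT) //=; apply: eq_bigr => b _.
rewrite -card_truncated_column_group -sum_nat_const.
apply: eq_big => [x|x /andP[_ /eqP <-]]; first by rewrite inE.
by rewrite col_size_block_union.
Qed.

Lemma block_inj (p q : 'I_s * 'I_s) :
  block m p.1 p.2 = block m q.1 q.2 -> p = q.
Proof.
case: p q => [i j] [k l] /= e.
have [x xi] := block_index_surj i; have [y yj] := block_index_surj j.
have : (x, y) \in block m k l by rewrite -e in_block xi yj !eqxx.
by rewrite in_block xi yj => /andP[/eqP -> /eqP ->].
Qed.

Lemma block_sub_union (F : {set 'I_s * 'I_s}) (i j : 'I_s) :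
  (block m i j \subset block_union m F) = ((i, j) \in F).
Proof.
apply/idP/idP => [/subsetP sub|Fij]; last exact: (bigcup_sup (i, j)).
have [x xi] := block_index_surj i; have [y yj] := block_index_surj j.
have /sub : (x, y) \in block m i j by rewrite in_block xi yj !eqxx.
by rewrite in_block_union xi yj.
Qed.

Lemma card_block_diagonal (F : ferrers s) i :
  #|block_diagonal m s i :&: blocks (block_version m F)| = #|diagonal s i :&: F|.
Proof.
rewrite -(card_imset _ block_inj); congr #|pred_of_set _|.
rewrite [RHS]imsetI; last by move=> p q _ _; apply: block_inj.
congr (_ :&: _); apply/setP => B; apply/imsetP/imsetP => -[[k l]].
  by rewrite inE /= block_sub_union => ? ->; exists (k, l).
by move=> ? ->; exists (k, l); rewrite // inE /= block_sub_union.
Qed.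

(** * Comparison of the minima *)

Section Scaling.

Variables (F : ferrers s) (delta d : nat).
Hypotheses (delta_gt0 : 0 < delta) (d_gt0 : 0 < d).
Hypothesis dE : d - 1 = m * (delta - 1).

Lemma scaled_excess a : (m * a).+1 - d = m * (a.+1 - delta).
Proof.
have -> : a.+1 - delta = a - (delta - 1) by lia.
by rewrite mulnBr -dE; lia.
Qed.

Lemma nu_block_version_mul q :
  nu (block_version m F) d (q * m) = m ^ 2 * nu F delta q.
Proof.
rewrite nu_block_version /nu big_distrr /= [RHS]big_mkcond /=.
apply: eq_bigr => b _; rewrite (mulnC q) -mulnDr scaled_excess.
rewrite (mulnC m q) -mulnBl; case: ltnP => bq.
  by rewrite (minn_idPl _) ?leq_pmull ?mulnA //; lia.
by rewrite (_ : s - b - q = 0) ?mul0n ?minn0 //; lia.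
Qed.

(** Concavity between two consecutive multiples of [m], in the form of the
    chord inequality multiplied by [m].  It holds for each group of columns
    separately. *)
Lemma nu_block_version_concave q r : r <= m ->
  (m - r) * nu (block_version m F) d (q * m) +
      r * nu (block_version m F) d (q.+1 * m) <=
    m * nu (block_version m F) d (q * m + r).
Proof.
move=> rm; rewrite !nu_block_version !big_distrr -big_split /=.
apply: leq_sum => b _; set c := col_size F b.
rewrite -(subnK d_gt0) dE !addn1 !subSS.
rewrite addnA (mulnC q) (mulnC q.+1) -!mulnDr (mulnC (s - b)) -!mulnBr.
rewrite subnDA -mulnBr.
(* [s - b - q] counts the groups from the [b]-th one to the last group that
   the removal of [q m] columns leaves; when it is [1], the [b]-th group is the
   one losing columns as [r] grows. *)
have -> : s - b - q.+1 = (s - b - q).-1 by lia.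
have mt k : 0 < k -> m <= m * k by move=> k0; rewrite leq_pmulr.
case: (s - b - q) => [|[|t]]; first by rewrite !(muln0, sub0n, minn0, mul0n).
- rewrite /= muln0 muln1 minn0 minnn mul0n muln0 addn0 (minn_idPr (leq_subr _ _)).
  rewrite (mulnCA m) leq_mul2l; apply/orP; right.
  by rewrite leq_mul2l; apply/orP; right; rewrite mulnBr; lia.
- rewrite /= !(minn_idPl _) ?mt //; last first.
    by have := mt t.+1 isT; rewrite (mulnS m t.+1); lia.
  rewrite (mulnCA (m - r)) (mulnCA r m) -mulnDr leq_mul2l; apply/orP; right.
  (* Heights are integers: if the positive part vanishes at the left endpoint
     because of a deficit of at least one, it vanishes at the right one too. *)
  have [ge|lt] := leqP (delta - 1) (c + q).
    have -> : m * (c + q) + r - m * (delta - 1) = m * (c + q - (delta - 1)) + r.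
      by rewrite (mulnBr m (c + q)) -addnBAC // leq_mul2l ge orbT.
    rewrite addnS subSn // (mulnS m) mulnDr addnCA -mulnDl subnK //.
    by rewrite mulnDr (mulnC r m) addnC.
  have -> : c + q - (delta - 1) = 0 by lia.
  have -> : c + q.+1 - (delta - 1) = 0 by lia.
  by rewrite !muln0.
Qed.

Lemma nu_min_block_version :
  nu_min (block_version m F) d = m ^ 2 * nu_min F delta.
Proof.
apply/eqP; rewrite eqn_leq; apply/andP; split.
  have [q qdelta ->] := nu_min_attained _ F _ delta_gt0.
  rewrite -nu_block_version_mul nu_min_le //.
  have : m * q <= m * (delta - 1) by rewrite leq_mul2l; lia.
  by rewrite -dE (mulnC q); lia.
have [j jd ->] := nu_min_attained _ (block_version m F) _ d_gt0.
have rm : j %% m < m by rewrite ltn_mod.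
rewrite (divn_eq j m); move: (j %/ m) (j %% m) rm (divn_eq j m) => q r rm jE.
have jle : m * q + r <= m * (delta - 1) by rewrite -dE (mulnC m) -jE; lia.
have qdelta : q < delta.
  have : q <= delta - 1 by rewrite -(leq_pmul2l m_gt0); lia.
  by lia.
have [->|r0] := posnP r.
  by rewrite addn0 nu_block_version_mul leq_mul2l nu_min_le ?orbT.
have q1delta : q.+1 < delta.
  have : q < delta - 1 by rewrite -(ltn_pmul2l m_gt0); lia.
  by lia.
rewrite -(leq_pmul2l m_gt0).
apply: leq_trans (nu_block_version_concave q r (ltnW rm)).
rewrite -[X in X * _](subnK (ltnW rm)) mulnDl !nu_block_version_mul.
by apply: leq_add; rewrite !leq_mul2l nu_min_le ?orbT.
Qed.

End Scaling.

End BlockVersion.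

(** * Equivalence of the two notions of constructibility *)

Theorem theorem4p15 (m s : nat) (hm : 0 < m) (hs : 0 < s) (F : ferrers s)
    (delta d : nat) (hdelta : 0 < delta <= s) (hd : 0 < d <= s * m)
    (hdd : d - 1 = m * (delta - 1)) :
  MDS_constructible F delta <-> MSRD_constructible (block_version m F) d.
Proof.
have [delta_gt0 _] := andP hdelta; have [d_gt0 _] := andP hd.
rewrite /MDS_constructible /MSRD_constructible.
rewrite (nu_min_block_version m s hm F delta d delta_gt0 d_gt0 hdd).
under [in X in _ <-> _ = X]eq_bigr => i _ do
  rewrite (card_block_diagonal m s hm) (scaled_excess m hm delta d delta_gt0 d_gt0 hdd).
rewrite -big_distrr /= mulnA mulnn; split=> [-> //|/eqP].
by rewrite eqn_pmul2l ?expn_gt0 ?hm // => /eqP.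
Qed.
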